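(* Let $\beta\in(0,1)$ be such that $n_-\beta$ is a positive integer, and choose $\phi=\phi_c$ with $\phi_c(\cdot)=\mathbb I(\cdot\in(0,1/\beta])$, i.e. the CVaR divergence with parameter $\beta$. Then the problem $$\min_{\mathbf w}\ \frac{1}{n_+}\sum_{\mathbf x_i\in\mathcal S_+}\hat L_{\phi}(\mathbf w;\mathbf x_i)$$ is equivalent to $$\min_{\mathbf w}\min_{\mathbf s\in\mathbb R^{n_+}} F(\mathbf w,\mathbf s)=\frac{1}{n_+}\sum_{\mathbf x_i\in\mathcal S_+}\Big(s_i+\frac1\beta\psi_i(\mathbf w,s_i)\Big),\qquad \psi_i(\mathbf w,s_i)=\frac1{n_-}\sum_{\mathbf x_j\in\mathcal S_-}\big(L(\mathbf w;\mathbf x_i,\mathbf x_j)-s_i\big)_+ ,$$ in the sense that for every $\mathbf w$ one has $\frac{1}{n_+}\sum_{\mathbf x_i\in\mathcal S_+}\hat L_{\phi}(\mathbf w;\mathbf x_i)=\min_{\mathbf s}F(\mathbf w,\mathbf s)$. Moreover, if $\ell(\cdot)$ is monotonically decreasing where $\ell(\cdot)>0$, then the objective $\frac{1}{n_+}\sum_{\mathbf x_i\in\mathcal S_+}\hat L_{\phi}(\mathbf w;\mathbf x_i)$ is equal, for every $\mathbf w$, to the one-way partial AUC surrogate objective $$\frac{1}{n_+}\sum_{\mathbf x_i\in\mathcal S_+}\frac{1}{n_-\beta}\sum_{\mathbf x_j\in\mathcal S_-^{\downarrow}[1,n_-\beta]}L(\mathbf w;\mathbf x_i,\mathbf x_j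).$$
   Context: $\mathcal S_+$ and $\mathcal S_-$ are finite sets of positive and negative training examples, $n_+=|\mathcal S_+|$, $n_-=|\mathcal S_-|$. $h_{\mathbf w}(\mathbf x)=h(\mathbf w,\mathbf x)\in\mathbb R$ is a score function with parameter $\mathbf w\in\mathbb R^d$. The pairwise loss is $L(\mathbf w;\mathbf x_i,\mathbf x_j)=\ell(h_{\mathbf w}(\mathbf x_i)-h_{\mathbf w}(\mathbf x_j))$ for $\mathbf x_i\in\mathcal S_+$, $\mathbf x_j\in\mathcal S_-$. Standing assumption on $\ell:\mathbb R\to\mathbb R$: it is convex, differentiable, monotonically decreasing where $\ell(\cdot)>0$, and $\ell'(0)<0$. $\mathcal S_-^{\downarrow}[k_1,k_2]$ is the subset of $\mathcal S_-$ of examples whose rank, when the scores $h_{\mathbf w}$ are sorted in descending order, lies in $[k_1,k_2]$ (ties broken arbitrarily). $(s)_+=\max(s,0)$. For each positive example, the distributionally robust loss is $$\hat L_\phi(\mathbf w;\mathbf x_i)=\max_{\mathbf p\in\Delta}\ \sum_{\mathbf x_j\in\mathcal S_-}p_jL(\mathbf w;\mathbf x_i,\mathbf x_j)-\lambda D_\phi(\mathbf p,1/n_-),$$ where $\Delta$ is the probability simplex in $\mathbb R^{n_-}$, $\lambda>0$, and $D_\phi$ is a divergence from the uniform distribution. For the CVaR divergence with parameter $\beta$, $D_{\phi_c}(\mathbf p,1/n_-)=0$ if $p_j\le 1/(n_-\beta)$ for all $j$, and $D_{\phi_c}(\mathbf p,1/n_-)=+\infty$ otherwise. *)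

(* Defs.v *)
From HB Require Import structures.
From mathcomp Require Export all_boot all_order all_algebra finmap.
From mathcomp Require Export all_classical all_reals all_analysis.

Set Implicit Arguments.
Unset Strict Implicit.
Unset Printing Implicit Defensive.

Export Order.TTheory GRing.Theory Num.Theory numFieldNormedType.Exports.

#[global] Open Scope classical_set_scope.
#[global] Open Scope ring_scope.

Definition is_max {d} {T : porderType d} (A : set T) (m : T) : Prop :=
  A m /\ ubound A m.

Definition is_min {d} {T : porderType d} (A : set T) (m : T) : Prop :=
  A m /\ lbound A m.

Section DistributionallyRobustLoss.
Context {R : realType} {X : choiceType}.

Definition simplex (S : {fset X}) : set {ffun S -> R} :=
  [set p | (forall j, 0 <= p j) /\ \sum_j p j = 1].
Arguments simplex : clear implicits.

(* Divergence from the uniform distribution for the CVaR choice of phi, the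
   indicator (0 or +oo) of a density ratio |S| p_j at most 1/beta. A zero
   weight p_j = 0 is allowed. *)
Definition cvar_div (beta : R) (S : {fset X}) (p : {ffun S -> R}) : \bar R :=
  if [forall j, p j <= 1 / (#|` S|%:R * beta)] then 0%E else +oo%E.
Arguments cvar_div : clear implicits.

Definition dro_objective (S : {fset X}) (D : {ffun S -> R} -> \bar R)
    (lambda : R) (L : X -> R) (p : {ffun S -> R}) : \bar R :=
  ((\sum_j p j * L (val j))%:E - lambda%:E * D p)%E.

(* The maximum over the simplex is written as a supremum; that it is attained
   has to be established separately (see [is_max]). *)
Definition dro_loss (S : {fset X}) (D : {ffun S -> R} -> \bar R)
    (lambda : R) (L : X -> R) : \bar R :=
  ereal_sup [set dro_objective D lambda L p | p in simplex S].

End DistributionallyRobustLoss.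

Arguments simplex {R X} S _.
Arguments cvar_div {R X} beta S p.

Section PairwiseObjectives.
Context {R : realType} {X : choiceType} {W : Type}.
Variables (h : W -> X -> R) (l : R -> R).

Definition pair_loss (w : W) (x y : X) : R := l (h w x - h w y).

Definition dro_avg (lambda beta : R) (Sp Sn : {fset X}) (w : W) : \bar R :=
  ((1 / #|` Sp|%:R)%:E *
    \sum_(i : Sp) dro_loss (cvar_div beta Sn) lambda
                           (pair_loss w (val i)))%E.

Definition psi (Sn : {fset X}) (w : W) (x : X) (t : R) : R :=
  1 / #|` Sn|%:R * \sum_(j : Sn) Num.max (pair_loss w x (val j) - t) 0.

Definition cvar_objective (beta : R) (Sp Sn : {fset X})
    (w : W) (s : {ffun Sp -> R}) : R :=
  1 / #|` Sp|%:R *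
    \sum_(i : Sp) (s i + 1 / beta * psi Sn w (val i) (s i)).

(* [r] lists the elements of [S] by descending score; when scores are tied
   there are several such [r], one for each way of breaking the ties. *)
Definition desc_ranking (w : W) (S : {fset X}) (r : seq X) : bool :=
  perm_eq r S && sorted (fun x y => h w y <= h w x) r.

Lemma desc_ranking_sort (w : W) (S : {fset X}) :
  desc_ranking w S (sort (fun x y => h w y <= h w x) S).
Proof.
rewrite /desc_ranking perm_sort perm_refl /=.
by apply: sort_sorted => x y; exact: le_total.
Qed.

(* Ranks start at 1. *)
Definition rank_range (S : {fset X}) (r : seq X) (k1 k2 : nat) : {fset X} :=
  [fset x in S | (k1 <= (index x r).+1 <= k2)%N]%fset.

Definition pauc_objective (beta : R) (k : nat) (Sp Sn : {fset X})
    (w : W) (r : seq X) : R :=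
  1 / #|` Sp|%:R *
    \sum_(i : Sp) (1 / (#|` Sn|%:R * beta) *
      \sum_(j : rank_range Sn r 1 k) pair_loss w (val i) (val j)).

End PairwiseObjectives.

(* Main.v *)
Require Import Defs.
From mathcomp Require Import ring lra.

(* Ranking the losses in descending order, let [V] be the average of the [k]
   largest ones.  Weak duality bounds every feasible value
   [\sum_j p_j a_j] by [s + k^-1 \sum_j (a_j - s)_+], for every [s].  Weights
   [1/k] on the top [k] examples and the threshold [s] equal to the [k]-th
   largest loss both achieve [V], so the maximum over the simplex and the
   minimum over [s] are both [V].  The minimum over the vector [s] separates
   over the positive examples.  Finally, a convex [l] which is decreasing where
   it is positive cannot increase anywhere, since along an increasing chord it
   would become positive and keep increasing; hence ranking by score also ranks
   by loss. *)

Section TopAverage.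
Context {R : realType} {X : choiceType}.
Implicit Types (a : X -> R) (S : {fset X}) (r : seq X) (k : nat) (s : R).

Definition top_avg k r a : R := k%:R^-1 * \sum_(j <- take k r) a j.

Definition hinge_avg k S a s : R :=
  s + k%:R^-1 * \sum_(j : S) Num.max (a (val j) - s) 0.

(** The weights sum to 1, so [s] can be pulled out; each remaining term is at most [p j] times the
    hinge, and [p j] is capped by [k%:R^-1]. *)
Lemma capped_mean_le_hinge_avg k S a s (p : {ffun S -> R}) :
  simplex S p -> (forall j, p j <= k%:R^-1) ->
  \sum_j p j * a (val j) <= hinge_avg k S a s.
Proof.
move=> [p_ge0 p_sum] p_le.
have -> : \sum_j p j * a (val j) = s + \sum_j p j * (a (val j) - s).
  under [in RHS]eq_bigr do rewrite mulrBr.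
  by rewrite sumrB -mulr_suml p_sum mul1r addrC subrK.
rewrite lerD2l mulr_sumr ler_sum // => j _.
apply: le_trans (ler_wpM2l (p_ge0 j) (_ : _ <= Num.max (a (val j) - s) 0)) _.
  by rewrite le_max lexx.
by rewrite ler_wpM2r // le_max lexx orbT.
Qed.

Section Ranking.
Variables (k : nat) (S : {fset X}) (a : X -> R) (r : seq X).
Hypothesis r_perm : perm_eq r S.
Hypotheses (k_gt0 : (0 < k)%N) (k_le : (k <= #|` S|)%N).

Let size_top : size (take k r) = k.
Proof. by rewrite size_take_min (perm_size r_perm); apply/minn_idPl. Qed.

Let k_neq0 : k%:R != 0 :> R.
Proof. by rewrite pnatr_eq0 -lt0n. Qed.

Lemma top_avg_uniform : exists p : {ffun S -> R},
  [/\ simplex S p, forall j, p j <= k%:R^-1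
    & \sum_j p j * a (val j) = top_avg k r a].
Proof.
pose q (x : X) : R := if x \in take k r then k%:R^-1 else 0.
(* Taking [b] constantly 1 gives the total mass, and [b := a] the value. *)
have sum_q b : \sum_(j : S) q (val j) * b (val j) = top_avg k r b.
  rewrite -(big_seq_fsetE _ _ xpredT (fun x => q x * b x)) /=.
  rewrite -(perm_big _ r_perm) /= -{1}(cat_take_drop k r) big_cat /=.
  rewrite [X in _ + X]big_seq [X in _ + X]big1 ?addr0 => [|x xdrop].
    rewrite /top_avg mulr_sumr [LHS]big_seq [RHS]big_seq.
    by apply: eq_bigr => x xtake; rewrite /q xtake.
  rewrite /q ifF ?mul0r //; apply: contraTF xdrop => xtake.
  have: uniq r by rewrite (perm_uniq r_perm) fset_uniq.
  rewrite -{1}(cat_take_drop k r) cat_uniq => /and3P[_ /hasPn nodup _].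
  by apply/negP => /nodup /=; rewrite xtake.
exists [ffun j => q (val j)]; split => [|j|].
- split => [j|]; first by rewrite ffunE /q; case: ifP; rewrite ?invr_ge0.
  under eq_bigr do rewrite ffunE -[q _]mulr1.
  rewrite (sum_q (fun=> 1)) /top_avg big_const_seq count_predT size_top.
  by rewrite iter_addr addr0 mulVf.
- by rewrite ffunE /q; case: ifP; rewrite ?invr_ge0.
- by under eq_bigr do rewrite ffunE; rewrite sum_q.
Qed.

Hypothesis r_sorted : sorted (fun x y => a y <= a x) r.

Lemma top_avg_threshold : exists s, hinge_avg k S a s = top_avg k r a.
Proof.
case: r r_perm r_sorted size_top => [|x0 r'].
  by move=> _ _ /= k0; move: k_gt0; rewrite -k0.
set r0 := x0 :: r' => r0_perm r0_sorted top_size.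
have size_r0 : (k <= size r0)%N by rewrite (perm_size r0_perm).
(* Positions count from 0, so this is the [k]-th largest loss: hinges vanish after the first [k]
   entries and are plain differences on them. *)
pose s := a (nth x0 r0 k.-1); exists s.
have a_nth : {in gtn (size r0) &, forall i j, (i <= j)%N ->
    a (nth x0 r0 j) <= a (nth x0 r0 i)}.
  apply: (sorted_leq_nth (leT := fun x y => a y <= a x)) => //.
  by move=> y x z /= ? /le_trans; exact.
have k1 : (k.-1 < size r0)%N by rewrite prednK.
rewrite /hinge_avg /top_avg.
rewrite -(big_seq_fsetE _ _ xpredT (fun x => Num.max (a x - s) 0)) /=.
rewrite -(perm_big _ r0_perm) /= -{1}(cat_take_drop k r0) big_cat /=.
have -> : \sum_(x <- drop k r0) Num.max (a x - s) 0 = 0.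
  rewrite big_seq big1 // => x /(nthP x0)[i].
  rewrite size_drop nth_drop => i_lt <-; apply/max_idPr; rewrite subr_le0.
  apply: a_nth; rewrite ?inE -?ltn_subRL //.
  by rewrite (leq_trans (leq_pred k)) ?leq_addr.
rewrite addr0.
have -> : \sum_(x <- take k r0) Num.max (a x - s) 0 =
          \sum_(x <- take k r0) (a x - s).
  rewrite big_seq [RHS]big_seq; apply: eq_bigr => x /(nthP x0)[i].
  rewrite top_size => i_lt <-; rewrite nth_take //.
  apply/max_idPl; rewrite subr_ge0.
  by apply: a_nth; rewrite ?inE ?(leq_trans i_lt) // -ltnS prednK.
rewrite sumrB big_const_seq count_predT top_size iter_addr addr0.
by rewrite mulrBr -[s *+ k]mulr_natl mulKf // addrC subrK.
Qed.

(** Weak duality, applied to the uniform weights on the top [k]. *)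
Lemma top_avg_le_hinge_avg s : top_avg k r a <= hinge_avg k S a s.
Proof.
by have [p [pS p_le <-]] := top_avg_uniform; exact: capped_mean_le_hinge_avg.
Qed.

Lemma cvar_dro_objective_max beta lambda :
  0 < lambda -> #|` S|%:R * beta = k%:R ->
  is_max [set dro_objective (cvar_div beta S) lambda a p | p in simplex S]
    (top_avg k r a)%:E.
Proof.
move=> lambda_gt0 k_def; split.
  have [p [pS p_le p_sum]] := top_avg_uniform.
  exists p => //; rewrite /dro_objective /cvar_div p_sum k_def ifT.
    by rewrite mule0 sube0.
  by apply/forallP => j; rewrite div1r.
move=> _ [p pS <-]; rewrite /dro_objective /cvar_div k_def.
(* A violated cap costs [lambda * +oo], so the objective is [-oo]. *)
case: ifPn => [/forallP p_le|_]; last by rewrite gt0_muley ?lte_fin // leNye.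
rewrite mule0 sube0 lee_fin; have [s <-] := top_avg_threshold.
by apply: capped_mean_le_hinge_avg => // j; rewrite -div1r.
Qed.

Lemma cvar_dro_lossE beta lambda :
  0 < lambda -> #|` S|%:R * beta = k%:R ->
  dro_loss (cvar_div beta S) lambda a = (top_avg k r a)%:E.
Proof.
move=> lambda_gt0 k_def.
have [Vin Vub] := cvar_dro_objective_max _ _ lambda_gt0 k_def.
by apply/eqP; rewrite eq_le (ge_ereal_sup Vub) ereal_sup_ubound.
Qed.

End Ranking.

(** Ranks start at 1 and [index] at 0, so rank at most [k] means membership in [take k r]. *)
Lemma sum_rank_range k S a r : perm_eq r S ->
  \sum_(j : rank_range S r 1 k) a (val j) = \sum_(j <- take k r) a j.
Proof.
move=> r_perm; rewrite -(big_seq_fsetE _ _ xpredT a) /=.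
apply: perm_big; apply: uniq_perm; first exact: fset_uniq.
  by rewrite take_uniq // (perm_uniq r_perm) fset_uniq.
move=> x; rewrite !inE /= -(perm_mem r_perm).
have [xr|xr] := boolP (x \in r); first by rewrite in_take.
by rewrite (contraNF (@mem_take _ _ _ _) xr).
Qed.

End TopAverage.

Section ConvexDecreasing.
Context {R : realType}.
Variable l : R -> R.
Hypothesis l_convex : convex_function (E := R^o) setT l.

(** The point [y] is the convex combination of [y + c * (y - x)] and [x] with weight [(1 + c)^-1] on
    the former; convexity is then scaled by [1 + c]. *)
Lemma convex_chord_extension (x y c : R) : 0 <= c ->
  l y + c * (l y - l x) <= l (y + c * (y - x)).
Proof.
move=> c_ge0; have c1_gt0 : 0 < 1 + c by rewrite ltr_pwDl.
have t_ge0 : 0 <= (1 + c)^-1 by rewrite invr_ge0 ltW.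
have t_le1 : (1 + c)^-1 <= 1 by rewrite invf_le1 // lerDl.
have chord : l ((1 + c)^-1 * (y + c * (y - x)) + (1 - (1 + c)^-1) * x) <=
    (1 + c)^-1 * l (y + c * (y - x)) + (1 - (1 + c)^-1) * l x.
  exact: (l_convex (Itv01 t_ge0 t_le1) (y + c * (y - x)) x
            (in_setT _) (in_setT _)).
have yE : (1 + c)^-1 * (y + c * (y - x)) + (1 - (1 + c)^-1) * x = y.
  by field; rewrite gt_eqF.
have lE u v : (1 + c) * ((1 + c)^-1 * u + (1 - (1 + c)^-1) * v) = u + c * v.
  by field; rewrite gt_eqF.
by move: chord; rewrite yE -(ler_pM2l c1_gt0) lE; lra.
Qed.

Lemma convex_decreasing_where_pos :
  {in [pred t | 0 < l t] &, {homo l : x y /~ x <= y}} ->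
  {homo l : x y /~ x <= y}.
Proof.
move=> l_decr y x xy; rewrite leNgt; apply/negP => lxy.
have x_lt_y : x < y.
  by rewrite lt_neqAle xy andbT; apply: contraTneq lxy => ->; rewrite ltxx.
have dl : 0 < l y - l x by rewrite subr_gt0.
(* Chosen so that the chord rises by [|l y| + 1] from [y] to [z], which forces [l z >= 1]. *)
pose c := (`|l y| + 1) / (l y - l x).
have c_gt0 : 0 < c by rewrite divr_gt0 // ltr_wpDl.
pose z := y + c * (y - x).
have lz : l y + `|l y| + 1 <= l z.
  apply: le_trans (convex_chord_extension x y _ (ltW c_gt0)).
  by rewrite /c divfK ?gt_eqF // addrA.
have ly_abs : - l y <= `|l y| by rewrite -normrN ler_norm.
have y_abs : 0 <= `|l y| by [].
have yz : y < z by rewrite ltrDl mulr_gt0 // subr_gt0.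
(* One more step of length [z - y] stays in the positive region and increases [l] again,
   contradicting [l_decr]. *)
have := convex_chord_extension y z _ ler01; rewrite !mul1r => lz'.
have : l (z + (z - y)) <= l z.
  by apply: l_decr; rewrite ?inE /=; lra.
lra.
Qed.

End ConvexDecreasing.


Theorem theorem1 (R : realType) (X : choiceType) (d : nat)
    (h : 'rV[R]_d -> X -> R) (l : R -> R) (Sp Sn : {fset X})
    (lambda beta : R) (k : nat)
    (l_convex : convex_function (E := R^o) setT l)
    (l_diff : forall t : R, derivable l t 1)
    (l_deriv0 : derive1 l 0 < 0)
    (Sp_gt0 : (0 < #|` Sp|)%N)
    (lambda_gt0 : 0 < lambda)
    (beta_gt0 : 0 < beta) (beta_lt1 : beta < 1)
    (k_gt0 : (0 < k)%N) (k_def : #|` Sn|%:R * beta = k%:R) :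
  [/\ forall (w : 'rV[R]_d) (i : Sp),
        is_max [set dro_objective (cvar_div beta Sn) lambda (pair_loss h l w (val i)) p
                 | p in simplex Sn]
               (dro_loss (cvar_div beta Sn) lambda
                  (pair_loss h l w (val i))),
      forall w : 'rV[R]_d,
        is_min [set (cvar_objective h l beta Sn w s)%:E
                 | s in [set: {ffun Sp -> R}]]
               (dro_avg h l lambda beta Sp Sn w)
    & {in [pred t | 0 < l t] &, {homo l : x y /~ x <= y}} ->
      forall (w : 'rV[R]_d) (r : seq X), desc_ranking h w Sn r ->
        dro_avg h l lambda beta Sp Sn w =
          (pauc_objective h l beta k Sp Sn w r)%:E].
Proof.
have k_le : (k <= #|` Sn|)%N.
  by rewrite -(ler_nat R) -k_def ler_piMr // ltW.
pose a w (i : Sp) := pair_loss h l w (val i).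
(* Sorting by loss, separately for each positive example, keeps the first two claims independent of
   any monotonicity of [l]. *)
pose rk w i := sort (fun x y => a w i y <= a w i x) Sn.
have rkP w i : perm_eq (rk w i) Sn /\
    sorted (fun x y => a w i y <= a w i x) (rk w i).
  (* With [id] for the score map, the parameter is itself the score function, here the loss. *)
  by have /andP[] := desc_ranking_sort id (a w i) Sn.
pose V w i := top_avg k (rk w i) (a w i).
have lossE w i : dro_loss (cvar_div beta Sn) lambda (a w i) = (V w i)%:E.
  by have [? ?] := rkP w i; exact: cvar_dro_lossE.
have avgE w : dro_avg h l lambda beta Sp Sn w =
    (1 / #|` Sp|%:R * \sum_(i : Sp) V w i)%:E.
  rewrite /dro_avg [RHS]EFinM -sumEFin; congr (_ * _)%E.
  by apply: eq_bigr => i _; exact: lossE.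
have cvarE w s : cvar_objective h l beta Sn w s =
    1 / #|` Sp|%:R * \sum_(i : Sp) hinge_avg k Sn (a w i) (s i).
  congr (_ * _); apply: eq_bigr => i _; rewrite /psi mulrA /hinge_avg -k_def.
  by congr (_ + _ * _); rewrite !div1r invfM mulrC.
split => [w i|w|l_decr w r /andP[r_perm r_sorted]].
- rewrite lossE; have [? ?] := rkP w i; exact: cvar_dro_objective_max.
- rewrite avgE; split.
    (* The objective separates over the coordinates of [s], so optimal thresholds are picked one by
       one. *)
    have /choice[s sP] : forall i, exists s, hinge_avg k Sn (a w i) s = V w i.
      by move=> i; have [? ?] := rkP w i; exact: top_avg_threshold.
    exists [ffun i => s i] => //; rewrite cvarE.
    by under eq_bigr do rewrite ffunE sP.
  move=> _ [s _ <-]; rewrite lee_fin cvarE ler_wpM2l ?div1r ?invr_ge0 //.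
  apply: ler_sum => i _; have [? ?] := rkP w i; exact: top_avg_le_hinge_avg.
- have l_noninc := convex_decreasing_where_pos _ l_convex l_decr.
  rewrite /dro_avg /pauc_objective [RHS]EFinM -sumEFin; congr (_ * _)%E.
  apply: eq_bigr => i _.
  rewrite (sum_rank_range k _ (a w i) _ r_perm) k_def div1r.
  (* A larger negative score means a smaller margin, hence a larger loss: the single ranking [r]
     serves every positive example. *)
  apply: cvar_dro_lossE => //; apply: sub_sorted r_sorted => x y /= hyx.
  by apply: l_noninc; rewrite lerD2l lerN2.
Qed.
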